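(* Let $S_1,S_2:[0,1]^2\to[0,1]$ be continuous cancellative t-subnorms with additive generators $s_1:[0,1]\to[s_1(1),\infty]$ and $s_2:[0,1]\to[s_2(1),\infty]$, respectively (normalized, i.e. $s_i(1)=1$, whenever $S_i$ is proper). If $S_1\le S_2$ (pointwise on $[0,1]^2$), then $$\lim_{x\to\infty}\frac{s_1\circ s_2^{-1}(x)}{x}=\inf_{x>s_2(1)}\frac{s_1\circ s_2^{-1}(x)}{x}<\infty.$$
   Context: A t-subnorm is a binary operation $S:[0,1]^2\to[0,1]$ that is commutative, associative, non-decreasing in both variables and satisfies $S(x,y)\le\min(x,y)$. It is cancellative if $S(x,y)=S(x,z)$ with $x>0$ implies $y=z$. A t-norm is a t-subnorm having $1$ as neutral element; a t-subnorm that is not a t-norm is called proper. By a known representation theorem, a t-subnorm $S$ is continuous and cancellative if and only if there is a continuous, strictly decreasing function $s:[0,1]\to[0,\infty]$ with $s(0)=\infty$ such that $S(x,y)=s^{-1}(s(x)+s(y))$ for all $x,y\in[0,1]$, where $s$ is viewed as a bijection $[0,1]\to[s(1),\infty]$ with inverse $s^{-1}$. Such an $s$ is called an additive generator of $S$; it is unique up to a positive multiplicative constant; $S$ is a (strict) t-norm iff $s(1)=0$ and proper iff $s(1)>0$. When $S$ is proper, its normalized additive generator is the one with $s(1)=1$. *)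

(* Defs.v *)
From HB Require Import structures.
From mathcomp Require Import all_boot all_order all_algebra.
From mathcomp Require Import all_classical all_reals all_analysis.
Import Order.TTheory GRing.Theory Num.Theory.
Import numFieldNormedType.Exports.

Set Implicit Arguments.
Unset Strict Implicit.
Unset Printing Implicit Defensive.

Local Open Scope classical_set_scope.
Local Open Scope ring_scope.

Definition unit_itv (R : realType) : set R := `[0, 1].
Arguments unit_itv {R}.

(* Operations on [0,1] are represented by functions on R; all the conditions
   below only constrain their values on the unit square. *)

Record t_subnorm (R : realType) (S : R -> R -> R) : Prop := {
  t_subnorm_closed : forall x y, unit_itv x -> unit_itv y -> unit_itv (S x y);
  t_subnormC : forall x y, unit_itv x -> unit_itv y -> S x y = S y x;
  t_subnormA : forall x y z, unit_itv x -> unit_itv y -> unit_itv z ->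
    S (S x y) z = S x (S y z);
  t_subnorm_le : forall x x' y y',
    unit_itv x -> unit_itv x' -> unit_itv y -> unit_itv y' ->
    x <= x' -> y <= y' -> S x y <= S x' y';
  t_subnorm_min : forall x y, unit_itv x -> unit_itv y ->
    S x y <= Num.min x y
}.

Definition cancellative (R : realType) (S : R -> R -> R) : Prop :=
  forall x y z, unit_itv x -> unit_itv y -> unit_itv z ->
    S x y = S x z -> 0 < x -> y = z.

Definition continuous_op (R : realType) (S : R -> R -> R) : Prop :=
  {within unit_itv `*` unit_itv, continuous (fun p : R * R => S p.1 p.2)}.

Definition t_norm (R : realType) (S : R -> R -> R) : Prop :=
  t_subnorm S /\ forall x, unit_itv x -> S 1 x = x /\ S x 1 = x.

Definition proper_t_subnorm (R : realType) (S : R -> R -> R) : Prop :=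
  t_subnorm S /\ ~ t_norm S.

(* The inverse of s restricted to [0,1]: a genuine inverse on the image
   s @` [0,1], which is [s 1, +oo] when s is an additive generator, and an
   unspecified value elsewhere. *)
Definition gen_inv (R : realType) (s : R -> \bar R) : \bar R -> R :=
  pinv unit_itv s.

Record additive_generator (R : realType) (S : R -> R -> R) (s : R -> \bar R)
    : Prop := {
  additive_generator_ge0 : forall x, unit_itv x -> (0 <= s x)%E;
  additive_generator_continuous : {within unit_itv, continuous s};
  additive_generator_decr : forall x y, unit_itv x -> unit_itv y ->
    x < y -> (s y < s x)%E;
  additive_generator0 : s 0 = +oo%E;
  additive_generatorE : forall x y, unit_itv x -> unit_itv y ->
    S x y = gen_inv s (s x + s y)%E
}.

(* Main.v *)
(** Put [f = s1 \o s2^-1].  Since [s1] is decreasing, [S1 <= S2] says exactly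
    that [f (u + v) <= f u + f v] for [u, v >= s2 1]; moreover [f] is
    nonnegative and nondecreasing, and finite at finite arguments.  For
    [x, y > s2 1] take the least [n] with [y < n x]; then
    [f y <= n f x <= (y / x + 1) f x], so that [f y / y <= f x / x + f x / y],
    and the limit is the infimum as in Fekete's lemma. *)

Require Import Defs.
From HB Require Import structures.
From mathcomp Require Import all_boot all_order all_algebra.
From mathcomp Require Import all_classical all_reals all_analysis.
From mathcomp Require Import lra.
Import Order.TTheory GRing.Theory Num.Theory.
Import numFieldNormedType.Exports.

Local Open Scope classical_set_scope.
Local Open Scope ring_scope.

Lemma fekete_nondecreasing (R : realType) (a : R) (f : R -> R) (a_ge0 : 0 <= a)
    (f_ge0 : forall x, a < x -> 0 <= f x)
    (f_homo : forall x y, a < x -> x <= y -> f x <= f y)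
    (f_sub : forall x y, a < x -> a < y -> f (x + y) <= f x + f y) :
  f x / x @[x --> +oo] --> inf [set f x / x | x in [set x | a < x]].
Proof.
set A := [set _ | _ in _].
have A_lb : lbound A 0.
  by move=> _ [x /= ax <-]; rewrite divr_ge0 ?f_ge0// ltW// (le_lt_trans a_ge0).
have A_inf : has_inf A.
  by split; [exists (f (a + 1) / (a + 1)), (a + 1) => //=; rewrite ltrDl|exists 0].
(* Only positive multiples: [f] is controlled beyond [a] only, and [x *+ 0] is not there. *)
have f_mul x n : a < x -> f (x *+ n.+1) <= f x *+ n.+1.
  move=> ax; have x0 : 0 < x by exact: le_lt_trans ax.
  elim: n => // n IHn; rewrite mulrS (mulrS (f x)).
  rewrite (le_trans (f_sub _ _ ax _)) ?lerD2l//.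
  by rewrite (lt_le_trans ax)// mulrS lerDl mulrn_wge0// ltW.
have f_bound x y : a < x -> a < y -> f y / y <= f x / x + f x / y.
  move=> ax ay; have x0 : 0 < x by exact: le_lt_trans ax.
  have y0 : 0 < y by exact: le_lt_trans ay.
  have yx0 : 0 <= y / x by rewrite divr_ge0// ltW.
  (* With [n <= y / x < n.+1], the upper bound gives [y <= x *+ n.+1] for monotonicity, and the
     lower one later bounds [f x *+ n] by [(y / x) * f x]. *)
  have /andP[nle ltn] := truncn_itv yx0.
  set n := Num.truncn _ in nle ltn.
  have fy : f y <= f x *+ n.+1.
    apply: le_trans (f_mul _ _ ax); apply: f_homo => //.
    by rewrite -mulr_natl -ler_pdivrMr// ltW.
  rewrite ler_pdivrMr// mulrDl divfK ?gt_eqF// (le_trans fy)// mulrSr lerD2r.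
  by rewrite -mulr_natr mulrAC -mulrA ler_wpM2l// f_ge0.
apply/cvgrPdist_lt => e e0.
(* One half pays for choosing a fixed [x] with [f x / x] near the infimum, the other for the error
   [f x / y], which vanishes as [y] grows. *)
have e20 : 0 < e / 2 by rewrite divr_gt0.
have [_ [x /= ax <-] xe] := inf_adherent e20 A_inf.
near=> y.
have ay : a < y by near: y; apply: nbhs_pinfty_gt; exact: num_real.
have y0 : 0 < y by exact: le_lt_trans ay.
have yL : inf A <= f y / y by apply: ge_inf; [exists 0|exists y].
have fxy : f x / y < e / 2.
  rewrite ltr_pdivrMr// mulrC -ltr_pdivrMr//.
  by near: y; apply: nbhs_pinfty_gt; exact: num_real.
rewrite distrC ger0_norm ?subr_ge0// ltrBlDl.
have := f_bound _ _ ax ay; lra.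
Unshelve. all: by end_near. Qed.

(** If [y] were missing from [A], then [t < y] and [t <= y] would cut out the same part of [A]. That
    part is clopen in [A] and contains [x], so it is all of [A], which [z] contradicts. *)
Lemma connected_between (R : realType) (A : set (\bar R)) (x y z : \bar R) :
  connected A -> A x -> A z -> (x <= y <= z)%E -> A y.
Proof.
move=> A_conn Ax Az /andP[xy yz]; apply: contrapT => nAy.
have lt_of t : A t -> (t <= y)%E -> (t < y)%E.
  by move=> At ty; rewrite lt_neqAle ty andbT; apply/eqP => ty'; rewrite ty' in At.
have AE : A `&` [set t | (t < y)%E] = A.
  apply: A_conn; first by exists x; split => //; exact: lt_of.
    by exists [set t | (t < y)%E] => //; exact: open_ereal_lt_ereal.
  exists [set t | (t <= y)%E]; first exact: closed_ereal_ge_ereal.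
  apply/seteqP; split=> t [At ty]; split=> //=; first exact: ltW.
  exact: lt_of.
by move: Az; rewrite -AE => -[_ /=]; rewrite ltNge yz.
Qed.

Lemma unit_itv0 (R : realType) : unit_itv (0 : R).
Proof. by rewrite /unit_itv /= in_itv/= lexx ler01. Qed.

Lemma unit_itv1 (R : realType) : unit_itv (1 : R).
Proof. by rewrite /unit_itv /= in_itv/= lexx ler01. Qed.

Section additive_generator_theory.
Context {R : realType} {S : R -> R -> R} {s : R -> \bar R}.
Hypothesis s_gen : additive_generator S s.

Lemma additive_generator_le x y : unit_itv x -> unit_itv y ->
  (s x <= s y)%E = (y <= x).
Proof.
move=> Ix Iy; have [yx|xy] := leP y x.
  move: yx; rewrite le_eqVlt => /predU1P[->|/(additive_generator_decr s_gen Iy Ix)/ltW//].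
  exact: lexx.
by apply/negbTE; rewrite -ltNge (additive_generator_decr s_gen).
Qed.

(** Intermediate values: the image of [[0, 1]] is connected and contains both [s 1] and
    [s 0 = +oo]. *)
Lemma additive_generator_surj e : (s 1 <= e)%E -> [set s t | t in unit_itv] e.
Proof.
move=> s1e.
apply: (@connected_between _ _ (s 1) e (s 0)).
- apply: connected_continuous_connected; last exact: additive_generator_continuous s_gen.
  by apply/connected_intervalP; exact: interval_is_interval.
- by exists 1 => //; exact: unit_itv1.
- by exists 0 => //; exact: unit_itv0.
- by rewrite s1e (additive_generator0 s_gen) leey.
Qed.

Lemma gen_inv_unit_itv e : (s 1 <= e)%E -> unit_itv (gen_inv s e).
Proof.
move=> /additive_generator_surj[t It <-].
rewrite /gen_inv pinvKV ?inE// => x y; rewrite !inE => Ix Iy sxy.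
by apply/eqP; rewrite eq_le -!additive_generator_le// sxy lexx.
Qed.

Lemma gen_invK e : (s 1 <= e)%E -> s (gen_inv s e) = e.
Proof. by move=> /additive_generator_surj se; rewrite /gen_inv pinvK ?inE. Qed.

Lemma additive_generator1_le x : unit_itv x -> (s 1 <= s x)%E.
Proof.
move=> Ix; rewrite additive_generator_le//; last exact: unit_itv1.
by move: Ix; rewrite /unit_itv /= in_itv/= => /andP[].
Qed.

(** Since [s 1 <= s x <= s x + s y], the sum stays in the range where [gen_inv s] is a genuine
    inverse. *)
Lemma additive_generator_op x y : unit_itv x -> unit_itv y ->
  s (S x y) = (s x + s y)%E.
Proof.
move=> Ix Iy; rewrite (additive_generatorE s_gen)// gen_invK//.
by rewrite (le_trans (additive_generator1_le _ Ix))// leeDl// (additive_generator_ge0 s_gen).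
Qed.

Lemma additive_generator_fin_num x : unit_itv x -> 0 < x -> s x \is a fin_num.
Proof.
move=> Ix x0; rewrite ge0_fin_numE ?(additive_generator_ge0 s_gen)//.
rewrite -(additive_generator0 s_gen) (additive_generator_decr s_gen)//.
exact: unit_itv0.
Qed.

End additive_generator_theory.

Theorem proposition4p1 (R : realType) (S1 S2 : R -> R -> R)
    (s1 s2 : R -> \bar R)
    (S1_subnorm : t_subnorm S1) (S1_cont : continuous_op S1)
    (S1_canc : cancellative S1)
    (S2_subnorm : t_subnorm S2) (S2_cont : continuous_op S2)
    (S2_canc : cancellative S2)
    (s1_gen : additive_generator S1 s1) (s2_gen : additive_generator S2 s2)
    (s1_normalized : proper_t_subnorm S1 -> s1 1 = 1%E)
    (s2_normalized : proper_t_subnorm S2 -> s2 1 = 1%E)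
    (S1_le_S2 : forall x y, unit_itv x -> unit_itv y -> S1 x y <= S2 x y) :
  let ratio : R -> \bar R := fun x => (s1 (gen_inv s2 x%:E) / x%:E)%E in
  let infimum : \bar R :=
    ereal_inf [set ratio x | x in [set x : R | (s2 1%R < x%:E)%E]] in
  ratio x @[x --> +oo] --> infimum /\ (infimum < +oo)%E.
Proof.
move=> ratio infimum.
have s21 := fineK (additive_generator_fin_num s2_gen _ (unit_itv1 R) ltr01).
set a := fine (s2 1) in s21.
have a_ge0 : 0 <= a by rewrite fine_ge0// (additive_generator_ge0 s2_gen (unit_itv1 R)).
have s2x x : a < x -> (s2 1%R <= x%:E)%E by move=> ax; rewrite -s21 lee_fin ltW.
pose t x := gen_inv s2 x%:E.
have It x : a < x -> unit_itv (t x).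
  by move=> ax; apply: (gen_inv_unit_itv s2_gen _); exact: s2x.
have s2t x : a < x -> s2 (t x) = x%:E.
  by move=> ax; apply: (gen_invK s2_gen _); exact: s2x.
(* [s2] is infinite at [0] but finite at [t x]. Positivity of [t x] then makes [s1 (t x)] finite. *)
have t_gt0 x : a < x -> 0 < t x.
  move=> ax; rewrite ltNge -(additive_generator_le s2_gen _ _ (unit_itv0 R) (It _ ax)).
  by rewrite (additive_generator0 s2_gen) s2t.
pose f x := fine (s1 (t x)).
have fE x : a < x -> s1 (t x) = (f x)%:E.
  by move=> ax; rewrite fineK// (additive_generator_fin_num s1_gen _ (It _ ax))// t_gt0.
have ratioE x : a < x -> ratio x = (f x / x)%:E.
  move=> ax; rewrite /ratio -/(t x) fE// inver gt_eqF ?EFinM//.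
  exact: le_lt_trans ax.
have f_ge0 x : a < x -> 0 <= f x.
  by move=> ax; rewrite fine_ge0// (additive_generator_ge0 s1_gen (It _ ax)).
(* Both [s1] and the inverse of [s2] reverse the order. *)
have f_homo x y : a < x -> x <= y -> f x <= f y.
  move=> ax xy; have ay := lt_le_trans ax xy.
  rewrite -lee_fin -!fE// (additive_generator_le s1_gen _ _ (It _ ax) (It _ ay)).
  by rewrite -(additive_generator_le s2_gen _ _ (It _ ax) (It _ ay)) !s2t// lee_fin.
(* Apply the decreasing [s1] to [S1 (t x) (t y) <= S2 (t x) (t y) <= t (x + y)]; the last inequality
   is read off after applying [s2]. *)
have f_sub x y : a < x -> a < y -> f (x + y) <= f x + f y.
  move=> ax ay.
  have axy : a < x + y by rewrite (lt_le_trans ax)// lerDl (le_trans a_ge0)// ltW.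
  rewrite -lee_fin EFinD -!fE// -(additive_generator_op s1_gen _ _ (It _ ax) (It _ ay)).
  have S1I := t_subnorm_closed S1_subnorm (It _ ax) (It _ ay).
  have S2I := t_subnorm_closed S2_subnorm (It _ ax) (It _ ay).
  rewrite (additive_generator_le s1_gen _ _ (It _ axy) S1I).
  rewrite (le_trans (S1_le_S2 _ _ (It _ ax) (It _ ay)))//.
  rewrite -(additive_generator_le s2_gen _ _ (It _ axy) S2I).
  by rewrite (additive_generator_op s2_gen _ _ (It _ ax) (It _ ay)) !s2t.
(* The set of ratios is nonempty and bounded below by [0], so its extended infimum is a real
   number. *)
have infE : infimum = (inf [set f x / x | x in [set x | a < x]])%:E.
  rewrite -ereal_inf_EFin; last 2 first.
  - exists 0 => _ [x /= ax <-].
    by rewrite divr_ge0 ?f_ge0// ltW// (le_lt_trans a_ge0).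
  - by exists (f (a + 1) / (a + 1)), (a + 1) => //=; rewrite ltrDl.
  rewrite image_comp /infimum -s21; congr ereal_inf.
  by apply: eq_imagel => x /=; rewrite lte_fin => ax; rewrite ratioE.
split; last by rewrite infE ltry.
(* [ratio x] is known to be the real number [f x / x] only for [x > a], which suffices at [+oo]. *)
rewrite infE; apply: cvg_EFin.
  by near=> x; rewrite ratioE//; near: x; apply: nbhs_pinfty_gt; exact: num_real.
apply: cvg_trans (fekete_nondecreasing _ _ _ a_ge0 f_ge0 f_homo f_sub).
apply: near_eq_cvg; near=> x.
by rewrite /= ratioE//; near: x; apply: nbhs_pinfty_gt; exact: num_real.
Unshelve. all: by end_near. Qed.
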